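(* Let $X$ be a completely regular space with a replete admissible family $\mathcal{O}$ of open coverings, let $S$ be a topological semigroup acting on $X$ with every map $\mu_s:X\to X$ continuous, and let $\mathcal{F}$ be a filter basis on the subsets of $S$. If the semigroup action $(S,X)$ has a global $\mathcal{F}$-attractor $\mathcal{A}$, then $(S,X)$ is $\mathcal{F}$-eventually bounded, $\mathcal{F}$-bounded dissipative, and $\mathcal{F}$-asymptotically compact, and $$\mathcal{A}=\bigcup_{Y\in\mathfrak{B}}\omega(Y,\mathcal{F})=\{x\in X:\text{there are a bounded net }(x_\lambda)\text{ in }X\text{ and a net }t_\lambda\to_{\mathcal{F}}\infty\text{ in }S\text{ with }t_\lambda x_\lambda\to x\},$$ where $\mathfrak{B}$ is the collection of all bounded subsets of $X$. Conversely, if $\omega(Y,\mathcal{F})$ is invariant for every bounded subset $Y$ of $X$ and $(S,X)$ is $\mathcal{F}$-eventually bounded, $\mathcal{F}$-bounded dissipative, and $\mathcal{F}$-asymptotically compact, then $(S,X)$ has a global $\mathcal{F}$-attractor.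
   Context: Coverings. For coverings $\mathcal{U},\mathcal{V}$ of $X$: $\mathcal{V}\leqslant\mathcal{U}$ means $\mathcal{V}$ refines $\mathcal{U}$ (each member of $\mathcal{V}$ is contained in some member of $\mathcal{U}$); $\mathcal{V}\leqslant\frac12\mathcal{U}$ means that for all $V,V'\in\mathcal{V}$ with $V\cap V'\neq\emptyset$ there is $U\in\mathcal{U}$ with $V\cup V'\subset U$. The star of $Y\subset X$ is $\mathrm{St}[Y,\mathcal{U}]=\bigcup\{U\in\mathcal{U}:Y\cap U\neq\emptyset\}$, and $\mathrm{St}[x,\mathcal{U}]=\mathrm{St}[\{x\},\mathcal{U}]$. A family $\mathcal{O}$ of open coverings of $X$ is admissible if: (1) for each $\mathcal{U}\in\mathcal{O}$ there is $\mathcal{V}\in\mathcal{O}$ with $\mathcal{V}\leqslant\frac12\mathcal{U}$; (2) if $Y\subset X$ is open and $K\subset Y$ is compact, there is $\mathcal{U}\in\mathcal{O}$ with $\mathrm{St}[K,\mathcal{U}]\subset Y$; (3) for $\mathcal{U},\mathcal{V}\in\mathcal{O}$ there is $\mathcal{W}\in\mathcal{O}$ with $\mathcal{W}\leqslant\mathcal{U}$ and $\mathcal{W}\leqslant\mathcal{V}$. It is replete if moreover $X=\bigcup_{\mathcal{U}\in\mathcal{O}}\mathrm{St}[x,\mathcal{U}]$ for every $x\in X$, and for $\mathcal{U},\mathcal{V}\in\mathcal{O}$ there is $\mathcal{W}\in\mathcal{O}$ with $\mathcal{U}\leqslant\frac12\mathcal{W}$ and $\mathcal{V}\leqslant\frac12\mathcal{W}$.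 (Completely regular spaces are not assumed Hausdorff.) A nonempty $Y\subset X$ is bounded if there is $\mathcal{U}\in\mathcal{O}$ with $y\in\mathrm{St}[x,\mathcal{U}]$ for all $x,y\in Y$. A net is bounded if its set of values is bounded. Actions. An action of $S$ on $X$ is a map $\mu:S\times X\to X$, $\mu(s,x)=sx$, with $s(tx)=(st)x$; $\mu_s(x)=sx$. For $A\subset S$, $Y\subset X$, $AY=\bigcup_{s\in A}\mu_s(Y)$. $Y$ is invariant if $sY=Y$ for every $s\in S$. A filter basis $\mathcal{F}$ on the subsets of $S$ is a nonempty family of subsets with $\emptyset\notin\mathcal{F}$ and such that for $A,B\in\mathcal{F}$ there is $C\in\mathcal{F}$ with $C\subset A\cap B$. A net $(t_\lambda)$ in $S$ satisfies $t_\lambda\to_{\mathcal{F}}\infty$ if for each $A\in\mathcal{F}$ there is $\lambda_0$ with $t_\lambda\in A$ for all $\lambda\geq\lambda_0$. The $\omega$-limit set is $\omega(Y,\mathcal{F})=\bigcap_{A\in\mathcal{F}}\mathrm{cls}(AY)$. $Y\subset X$ attracts $Z\subset X$ if for each $\mathcal{U}\in\mathcal{O}$ there is $A\in\mathcal{F}$ with $AZ\subset\mathrm{St}[Y,\mathcal{U}]$; $Y$ absorbs $Z$ if there is $A\in\mathcal{F}$ with $AZ\subset Y$. $(S,X)$ is: $\mathcal{F}$-eventually bounded if for each bounded $Y\subset X$ there is $A\in\mathcal{F}$ with $AY$ bounded; $\mathcal{F}$-bounded dissipative if there is a bounded $D\subset X$ absorbing every bounded subset of $X$; $\mathcal{F}$-asymptotically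 compact if for every bounded net $(x_\lambda)$ in $X$ and every net $(t_\lambda)$ in $S$ (same index set) with $t_\lambda\to_{\mathcal{F}}\infty$, the net $(t_\lambda x_\lambda)$ has a convergent subnet. A global $\mathcal{F}$-attractor is a subset $\mathcal{A}\subset X$ that is nonempty, closed, compact, invariant, and attracts every bounded subset of $X$. *)

(* Defs.v *)
From HB Require Import structures.
From mathcomp Require Import all_boot all_order all_algebra.
From mathcomp Require Import all_classical all_reals topology normedtype.

Set Implicit Arguments.
Unset Strict Implicit.
Unset Printing Implicit Defensive.

Local Open Scope classical_set_scope.

HB.mixin Record Semigroup_isTopological S of Topological S & Semigroup S := {
  smul_continuous : continuous (fun st : S * S => (st.1 * st.2)%g)
}.

#[short(type="topologicalSemigroupType")]
HB.structure Definition TopologicalSemigroup :=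
  {S of Topological S & Semigroup S & Semigroup_isTopological S}.

Definition open_covering (X : topologicalType) (U : set (set X)) : Prop :=
  U `<=` open /\ cover U id = [set: X].

Definition refines (X : Type) (V U : set (set X)) : Prop :=
  forall W, V W -> exists2 W', U W' & W `<=` W'.

Definition half_refines (X : Type) (V U : set (set X)) : Prop :=
  forall W W', V W -> V W' -> W `&` W' !=set0 ->
    exists2 Z, U Z & W `|` W' `<=` Z.

Definition star (X : Type) (Y : set X) (U : set (set X)) : set X :=
  \bigcup_(W in [set W | U W /\ Y `&` W !=set0]) W.

Record admissible (X : topologicalType) (O : set (set (set X))) : Prop := {
  admissible_open : forall U, O U -> open_covering U;
  admissible_half : forall U, O U -> exists2 V, O V & half_refines V U;
  admissible_star : forall Y K : set X, open Y -> compact K -> K `<=` Y ->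
    exists2 U, O U & star K U `<=` Y;
  admissible_meet : forall U V, O U -> O V ->
    exists W, [/\ O W, refines W U & refines W V]
}.

Record replete (X : topologicalType) (O : set (set (set X))) : Prop := {
  replete_admissible : admissible O;
  replete_star : forall x : X, [set: X] = \bigcup_(U in O) star [set x] U;
  replete_join : forall U V, O U -> O V ->
    exists W, [/\ O W, half_refines U W & half_refines V W]
}.

(* Bounded sets are nonempty by convention. *)
Definition cov_bounded (X : Type) (O : set (set (set X))) (Y : set X) : Prop :=
  Y !=set0 /\
  exists2 U, O U & forall x y, Y x -> Y y -> star [set x] U y.

Record directed (I : Type) (le : I -> I -> Prop) : Prop := {
  directed_inhabited : inhabited I;
  directed_refl : forall i, le i i;
  directed_trans : forall i j k, le i j -> le j k -> le i k;
  directed_ub : forall i j, exists k, le i k /\ le j k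
}.

(* The filter of tails: a net [x : I -> X] converges to [p] iff
   [x @ tails le --> p]. *)
Definition tails (I : Type) (le : I -> I -> Prop) : set_system I :=
  filter_from [set: I] (fun i0 => [set i | le i0 i]).

(* Subnets in the sense of Kelley: the reindexing [h] is eventually above every
   index, but need not be monotone. *)
Definition has_convergent_subnet (X : topologicalType) (I : Type)
    (le : I -> I -> Prop) (x : I -> X) : Prop :=
  exists (J : Type) (leJ : J -> J -> Prop) (h : J -> I),
    [/\ directed leJ,
        (forall i, exists j0, forall j, leJ j0 j -> le i (h j)) &
        exists p : X, (x \o h) @ tails leJ --> p].

Definition bounded_net (X : Type) (O : set (set (set X))) (I : Type)
    (x : I -> X) : Prop := cov_bounded O (range x).

Definition is_action (S : semigroupType) (X : Type) (mu : S -> X -> X) : Prop :=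
  forall s t x, mu s (mu t x) = mu (s * t)%g x.

Definition act (S X : Type) (mu : S -> X -> X) (A : set S) (Y : set X) : set X :=
  \bigcup_(s in A) (mu s @` Y).

Definition invariant_set (S X : Type) (mu : S -> X -> X) (Y : set X) : Prop :=
  forall s, mu s @` Y = Y.

Definition filter_basis (S : Type) (F : set (set S)) : Prop :=
  [/\ F !=set0, ~ F set0 &
      forall A B, F A -> F B -> exists2 C, F C & C `<=` A `&` B].

Definition diverges (S : Type) (F : set (set S)) (I : Type)
    (le : I -> I -> Prop) (t : I -> S) : Prop :=
  forall A, F A -> exists i0, forall i, le i0 i -> A (t i).

Definition omega_limit (S : Type) (X : topologicalType) (mu : S -> X -> X)
    (F : set (set S)) (Y : set X) : set X :=
  \bigcap_(A in F) closure (act mu A Y).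

Definition attracts (S X : Type) (O : set (set (set X))) (mu : S -> X -> X)
    (F : set (set S)) (Y Z : set X) : Prop :=
  forall U, O U -> exists2 A, F A & act mu A Z `<=` star Y U.

Definition absorbs (S X : Type) (mu : S -> X -> X) (F : set (set S))
    (Y Z : set X) : Prop :=
  exists2 A, F A & act mu A Z `<=` Y.

Definition eventually_bounded (S X : Type) (O : set (set (set X)))
    (mu : S -> X -> X) (F : set (set S)) : Prop :=
  forall Y, cov_bounded O Y -> exists2 A, F A & cov_bounded O (act mu A Y).

Definition bounded_dissipative (S X : Type) (O : set (set (set X)))
    (mu : S -> X -> X) (F : set (set S)) : Prop :=
  exists2 D, cov_bounded O D &
    forall Y, cov_bounded O Y -> absorbs mu F D Y.

Definition asymptotically_compact (S : Type) (X : topologicalType)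
    (O : set (set (set X))) (mu : S -> X -> X) (F : set (set S)) : Prop :=
  forall (I : Type) (le : I -> I -> Prop) (x : I -> X) (t : I -> S),
    directed le -> bounded_net O x -> diverges F le t ->
    has_convergent_subnet le (fun i => mu (t i) (x i)).

Record global_attractor (S : Type) (X : topologicalType)
    (O : set (set (set X))) (mu : S -> X -> X) (F : set (set S))
    (A : set X) : Prop := {
  attractor_neq0 : A !=set0;
  attractor_closed : closed A;
  attractor_compact : compact A;
  attractor_invariant : invariant_set mu A;
  attractor_attracts : forall Y, cov_bounded O Y -> attracts O mu F A Y
}.

(* Main.v *)
(** If [x_i] lies in [Y] and [t_i] diverges, every cluster point of [t_i x_i] is
    in [omega(Y)]; conversely every filter meeting all the sets [A Y] has such a
    net converging to it.  So asymptotic compactness says that a filter meeting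
    all [A Y], [Y] bounded, has a cluster point in [omega(Y)].

    Given an attractor [K], the stars of [K] are bounded, hence eventual
    boundedness and dissipativity, and a net that is eventually in each star of
    the compact set [K] has a cluster point in [K].  A point of [omega(Y)]
    outside [K] would be separated from [K] by a covering.

    Conversely let [D] be a bounded absorbing set.  As [omega(Y)] is contained in
    [closure D], invariance gives [omega(Y) = s omega(Y)], contained in
    [closure (s D)]; thus [omega(Y)] lies in [omega(D)], and [omega(D)] is the
    attractor. *)
Require Import Defs.
From mathcomp Require Import all_boot all_order all_algebra.
From mathcomp Require Import all_classical all_reals topology normedtype.

Set Implicit Arguments.
Unset Strict Implicit.
Unset Printing Implicit Defensive.

Local Open Scope classical_set_scope.

(** * Tails of nets, cluster points and convergent subnets *)

Lemma tails_proper {I : Type} {le : I -> I -> Prop} :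
  directed le -> ProperFilter (tails le).
Proof.
move=> [[i0] le_refl le_trans le_ub]; apply: filter_from_proper.
  apply: filter_from_filter; first by exists i0.
  move=> i j _ _; have [k [ik jk]] := le_ub i j.
  by exists k => // l kl; split; apply: le_trans kl.
by move=> i _; exists i; apply: le_refl.
Qed.

Lemma subnet_cluster (X : topologicalType) (I : Type) (le : I -> I -> Prop)
    (z : I -> X) :
  has_convergent_subnet le z -> cluster (z @ tails le) !=set0.
Proof.
move=> [J [leJ [h [dirJ h_cofinal [p zhp]]]]]; exists p => A B [i _ iA] pB.
have [j0 j0P] := h_cofinal i.
have [j1 _ j1P] := zhp _ pB.
have [j [j0j j1j]] := directed_ub dirJ j0 j1.
by exists (z (h j)); split; [apply/iA/j0P|apply: j1P].
Qed.

(** A cluster point [p] is the limit of the subnet indexed by pairs [(i, N)], where [N] is a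
    neighbourhood of [p] containing [z i]. Pairs are ordered by the index and by reverse inclusion
    of neighbourhoods. *)
Lemma cluster_subnet (X : topologicalType) (I : Type) (le : I -> I -> Prop)
    (z : I -> X) : directed le ->
  cluster (z @ tails le) !=set0 -> has_convergent_subnet le z.
Proof.
move=> dirI [p clp].
have frequently i N : nbhs p N -> exists2 j, le i j & N (z j).
  move=> pN; have [||_ [[j ij <-] Nj]] := clp (z @` [set j | le i j]) N => //.
    by exists i => // j ij; exists j.
  by exists j.
pose J := {a : I * set X | nbhs p a.2 /\ a.2 (z a.1)}.
pose leJ (a b : J) := le (sval a).1 (sval b).1 /\ (sval b).2 `<=` (sval a).2.
exists J, leJ, (fun a => (sval a).1); split.
- split.
  + have [i0] := directed_inhabited dirI.
    by constructor; exists (i0, setT); split => //; exact: filterT.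
  + by move=> a; split => //; exact (directed_refl dirI _).
  + move=> a b c [ab ba] [bc cb]; split; last by move=> x /cb /ba.
    exact (directed_trans dirI ab bc).
  + move=> [[i M] [/= pM Mi]] [[j N] [/= pN Nj]].
    have [k [ik jk]] := directed_ub dirI i j.
    have pMN : nbhs p (M `&` N) by exact: filterI.
    have [l kl MNl] := frequently k _ pMN.
    exists (exist _ (l, M `&` N) (conj pMN MNl)).
    split; split=> /= [|x []//].
      exact (directed_trans dirI ik kl).
    exact (directed_trans dirI jk kl).
- move=> i; have [j ij zj] := frequently i _ (@filterT _ (nbhs p) _).
  exists (exist _ (j, setT) (conj filterT zj)) => -[[k N] kN] [/= jk _].
  exact (directed_trans dirI ij jk).
- exists p => N pN; have [i0] := directed_inhabited dirI.
  have [j _ Nj] := frequently i0 _ pN.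
  by exists (exist _ (j, N) (conj pN Nj)) => // -[[k M] [pM Mk]] [_ /=]; exact.
Qed.

(** * Nets of translates along the filter basis *)

Section ActionNets.
Context {S : Type} {X : topologicalType} (mu : S -> X -> X) {F : set (set S)}.
Hypothesis F_basis : filter_basis F.

Lemma cluster_omega_limit (Y : set X) (I : Type) (le : I -> I -> Prop)
    (x : I -> X) (t : I -> S) : range x `<=` Y -> diverges F le t ->
  cluster ((fun i => mu (t i) (x i)) @ tails le) `<=` omega_limit mu F Y.
Proof.
move=> xY tF p clp A FA N pN; apply: clp => //.
have [i0 i0A] := tF _ FA; exists i0 => // i /i0A Ai.
by exists (t i) => //; exists (x i) => //; apply: xY; exists i.
Qed.

(** Indices are tuples [(A, E, s, y)] with [s] in [A], [y] in [Y] and [mu s y] in [E], ordered by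
    reverse inclusion of [A] and [E] alone. Shrinking [A] makes [t] diverge; shrinking [E] gives
    convergence to [G]. *)
Lemma exists_diverging_net (Y : set X) (G : set_system X) : Filter G ->
  (forall A E, F A -> G E -> (act mu A Y `&` E) !=set0) ->
  exists (I : Type) (le : I -> I -> Prop) (x : I -> X) (t : I -> S),
    [/\ directed le, range x `<=` Y, diverges F le t &
        (fun i => mu (t i) (x i)) @ tails le --> G].
Proof.
move=> filterG meets; have [[A0 FA0] _ F_meet] := F_basis.
pose good (a : set S * set X * S * X) :=
  [/\ F a.1.1.1, G a.1.1.2, a.1.1.1 a.1.2, Y a.2 & a.1.1.2 (mu a.1.2 a.2)].
pose I := {a | good a}.
pose le (a b : I) := (sval b).1.1.1 `<=` (sval a).1.1.1 /\
                     (sval b).1.1.2 `<=` (sval a).1.1.2.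
have exI A E : F A -> G E -> exists a : I, (sval a).1.1 = (A, E).
  move=> FA GE; have [_ [[s As [y Yy <-]] Ey]] := meets _ _ FA GE.
  have g : good (A, E, s, y) by split.
  by exists (exist _ _ g).
exists I, le, (fun a => (sval a).2), (fun a => (sval a).1.2); split.
- split.
  + by have [a _] := exI _ _ FA0 filterT; constructor.
  + by move=> a; split.
  + by move=> a b c [ab1 ab2] [bc1 bc2]; split=> [s /bc1 /ab1|s /bc2 /ab2].
  + move=> [[[[A E] s] y] [/= FA GE ? ? ?]].
    move=> [[[[B E'] s'] y'] [/= FB GE' ? ? ?]].
    have [C FC CAB] := F_meet _ _ FA FB.
    have [c cE] := exI _ _ FC (filterI GE GE').
    by exists c; rewrite /le cE /=; split; split=> u; (case/CAB || case).
- by move=> _ [[a [? ? ? ? ?]] _ <-].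
- move=> A FA; have [a aE] := exI _ _ FA filterT.
  exists a => -[b [? ? ? ? ?]] [/=]; rewrite aE /= => bA _; exact: bA.
- move=> E GE; have [a aE] := exI _ _ FA0 GE.
  exists a => // -[b [? ? ? ? ?]] [/= _]; rewrite aE /= => bE; exact: bE.
Qed.

End ActionNets.

(** * Stars and bounded sets for a replete family *)

Section Coverings.
Context {X : topologicalType} {O : set (set (set X))}.
Hypothesis O_replete : replete O.
Let O_adm := replete_admissible O_replete.

Lemma star1P (U : set (set X)) (x y : X) :
  star [set x] U y <-> exists W, [/\ U W, W x & W y].
Proof.
split=> [[W [UW [_ [-> Wx]]] Wy]|[W [UW Wx Wy]]]; exists W => //.
by split => //; exists x.
Qed.

Lemma open_star (Y : set X) (U : set (set X)) : O U -> open (star Y U).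
Proof.
move=> OU; apply: bigcup_open => W [UW _].
by have [+ _] := admissible_open O_adm OU; apply.
Qed.

Lemma sub_star (Y : set X) (U : set (set X)) : O U -> Y `<=` star Y U.
Proof.
move=> OU y Yy; have [_ covU] := admissible_open O_adm OU.
have [W UW Wy] : cover U id y by rewrite covU.
by exists W => //; split => //; exists y.
Qed.

(** A triangle inequality: with [star [set x] U] read as a ball about [x], two points of one ball
    are close at the doubled scale [V]. *)
Lemma half_refines_star (U V : set (set X)) (x y z : X) : half_refines U V ->
  star [set x] U y -> star [set x] U z -> star [set y] V z.
Proof.
move=> UV /star1P[W [UW Wx Wy]] /star1P[W' [UW' Wx' Wz']].
have [||//|Z VZ WZ] := UV W W' => //; first by exists x.
by apply/star1P; exists Z; split => //; apply: WZ; [left|right].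
Qed.

Lemma star1_sym (U : set (set X)) (x y : X) :
  star [set x] U y -> star [set y] U x.
Proof. by move=> /star1P[W [? ? ?]]; apply/star1P; exists W. Qed.

Lemma star1_center (U : set (set X)) (x y : X) :
  star [set x] U y -> star [set x] U x.
Proof. by move=> /star1P[W [? ? ?]]; apply/star1P; exists W. Qed.

Lemma half_refines_star1 (U V : set (set X)) (x : X) : half_refines U V ->
  star [set x] U `<=` star [set x] V.
Proof.
move=> UV y xy; exact: half_refines_star UV (star1_center xy) xy.
Qed.

Lemma cov_boundedP (Y : set X) : cov_bounded O Y <->
  Y !=set0 /\ exists x, exists2 U, O U & Y `<=` star [set x] U.
Proof.
split=> [[[x Yx] [U OU YU]]|[Y0 [x [U OU YU]]]].
  by split; [exists x|exists x, U => // y; exact: YU].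
have [W [OW UW _]] := replete_join O_replete OU OU.
split => //; exists W => // y z /YU xy /YU xz.
exact: half_refines_star UW xy xz.
Qed.

Lemma sub_cov_bounded (Y Z : set X) :
  Y !=set0 -> Y `<=` Z -> cov_bounded O Z -> cov_bounded O Y.
Proof.
move=> Y0 YZ [_ [U OU ZU]]; split => //; exists U => // x y /YZ Zx /YZ Zy.
exact: ZU.
Qed.

Lemma star_cov_bounded (Y : set X) (U : set (set X)) :
  O U -> cov_bounded O Y -> cov_bounded O (star Y U).
Proof.
move=> OU bY; have /cov_boundedP[[y0 Yy0] [x [V OV YV]]] := bY.
apply/cov_boundedP; split; first by exists y0; exact: sub_star.
(* [W] is coarser than both coverings and links [y] to [z] and to [x]; a further doubling [T] links
   [x] to [z]. *)
have [W [OW UW VW]] := replete_join O_replete OU OV.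
have [T [OT WT _]] := replete_join O_replete OW OW.
exists x, T => // z [M [UM [y [Yy My]]] Mz].
have yz : star [set y] W z.
  by apply: half_refines_star1 UW _ _; apply/star1P; exists M.
have yx : star [set y] W x.
  by apply: half_refines_star1 VW _ _; apply/star1_sym/YV.
exact: half_refines_star WT yx yz.
Qed.

Lemma replete_nonempty (x : X) : O !=set0.
Proof.
have : [set: X] x by [].
by rewrite (replete_star O_replete x) => -[U OU _]; exists U.
Qed.

Lemma closure_sub_star (Y : set X) (U : set (set X)) :
  O U -> closure Y `<=` star Y U.
Proof.
move=> OU x clYx.
have xU : nbhs x (star [set x] U).
  by apply: open_nbhs_nbhs; split; [exact: open_star|exact: sub_star].
have [y [Yy /star1P[W [UW Wx Wy]]]] := clYx _ xU.
by exists W => //; split => //; exists y.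
Qed.

Lemma closure_cov_bounded (Y : set X) :
  cov_bounded O Y -> cov_bounded O (closure Y).
Proof.
move=> bY; have [[y Yy] [U OU _]] := bY.
apply: (@sub_cov_bounded _ (star Y U)); last exact: star_cov_bounded.
  by exists y; exact: subset_closure.
exact: closure_sub_star.
Qed.

(** The stars of a fixed [x] are open, directed under inclusion and exhaust the space, so a single
    one contains [K]. *)
Lemma compact_cov_bounded (K : set X) :
  K !=set0 -> compact K -> cov_bounded O K.
Proof.
move=> K0 /compact_near_coveringP Kcov; apply/cov_boundedP; split => //.
have [x _] := K0; exists x.
(* [G] is the filter of sufficiently large coverings, compared through their stars at [x] only. *)
pose above U := [set V | O V /\ star [set x] U `<=` star [set x] V].
pose G := filter_from O above.
have GF : Filter G.
  apply: filter_from_filter; first exact: replete_nonempty.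
  move=> U V OU OV; have [W [OW UW VW]] := replete_join O_replete OU OV.
  exists W => // T [OT WT].
  by split; split=> // y xy; apply: WT; [move: UW|move: VW];
    move=> /half_refines_star1; apply.
have [U OU UK] : G (fun U => K `<=` star [set x] U).
  apply: (Kcov _ G (fun U => star [set x] U)) => y _.
  have : [set: X] y by [].
  rewrite (replete_star O_replete x) => -[U OU xy].
  exists (star [set x] U, above U) => /=; last by case=> z V /= [? [_]]; exact.
  split; last by exists U.
  by apply: open_nbhs_nbhs; split => //; exact: open_star.
by exists U => //; apply: UK; split.
Qed.

End Coverings.

(** * Omega-limit sets as sets of limits of nets *)

Section Attractor.
Context {X : topologicalType} {O : set (set (set X))} {S : Type}.
Context {mu : S -> X -> X} {F : set (set S)}.
Hypotheses (O_replete : replete O) (F_basis : filter_basis F).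
Let O_adm := replete_admissible O_replete.

Lemma basis_neq0 (A : set S) : F A -> A !=set0.
Proof.
have [_ F0 _] := F_basis => FA.
by apply/set0P/eqP => A0; apply: F0; rewrite -A0.
Qed.

Lemma act_neq0 (A : set S) (Y : set X) :
  F A -> Y !=set0 -> act mu A Y !=set0.
Proof.
by move=> /basis_neq0[s As] [y Yy]; exists (mu s y), s => //; exists y.
Qed.

Lemma act_invariant (A : set S) (Y : set X) :
  F A -> invariant_set mu Y -> act mu A Y = Y.
Proof.
move=> /basis_neq0[s As] invY; apply/seteqP; split=> [_ [u _ [y Yy <-]]|y].
  by rewrite -(invY u); exists y.
by rewrite -{1}(invY s) => sy; exists s.
Qed.

Lemma omega_limit_netP (p : X) :
  (\bigcup_(Y in cov_bounded O) omega_limit mu F Y) p <->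
  exists (I : Type) (le : I -> I -> Prop) (x : I -> X) (t : I -> S),
    [/\ directed le, bounded_net O x, diverges F le t &
        (fun i => mu (t i) (x i)) @ tails le --> p].
Proof.
split=> [[Y bY omp]|[I [le [x [t [dirI bx tF zp]]]]]].
  have meets A N : F A -> nbhs p N -> (act mu A Y `&` N) !=set0.
    by move=> FA; exact: omp.
  have [I [le [x [t [dirI xY tF zp]]]]] := exists_diverging_net F_basis _ meets.
  exists I, le, x, t; split => //; have [i] := directed_inhabited dirI.
  by apply: sub_cov_bounded bY => //; exists (x i); exists i.
exists (range x) => //; apply: (cluster_omega_limit (@subset_refl _ _) tF).
move=> A B zA pB.
have tailsF := tails_proper dirI.
exact: filter_ex (filterI zA (zp _ pB)).
Qed.

(** * Consequences of the existence of an attractor *)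

Lemma attractor_eventually_bounded (K : set X) :
  global_attractor O mu F K -> eventually_bounded O mu F.
Proof.
move=> [K0 _ Kc _ Katt] Y bY; have [x _] := K0.
have [U OU] := replete_nonempty O_replete x.
have [A FA AK] := Katt _ bY _ OU; exists A => //.
apply: sub_cov_bounded AK _; first by apply: act_neq0 => //; case: bY.
exact/star_cov_bounded/compact_cov_bounded.
Qed.

Lemma attractor_bounded_dissipative (K : set X) :
  global_attractor O mu F K -> bounded_dissipative O mu F.
Proof.
move=> [K0 _ Kc _ Katt]; have [x _] := K0.
have [U OU] := replete_nonempty O_replete x; exists (star K U).
  exact/star_cov_bounded/compact_cov_bounded.
by move=> Y bY; apply: Katt.
Qed.

Lemma attractor_asymptotically_compact (K : set X) :
  global_attractor O mu F K -> asymptotically_compact O mu F.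
Proof.
move=> [K0 _ Kc _ Katt] I le x t dirI bx tF.
apply: cluster_subnet => //; set z := fun i => _.
apply: contrapT => nocl; have tailsF := tails_proper dirI.
pose tail i := [set z j | j in le i].
(* Each point of [K] has a neighbourhood missed by the late terms; compactness gives one index whose
   tail has closure disjoint from [K]. *)
have [i0 _ i0K] : tails le (fun i => K `<=` ~` closure (tail i)).
  have /compact_near_coveringP Kcov := Kc.
  apply: (Kcov _ (tails le) (fun i => ~` closure (tail i))) => a _.
  have /existsNP[A /existsNP[N /not_implyP[[i1 _ i1A] /not_implyP[aN AN]]]] :
      ~ cluster (z @ tails le) a by move=> cla; apply: nocl; exists a.
  (* With the interior, [N] is a neighbourhood of each nearby [b] as well, which keeps [b] out of
     the closure of the tail. *)
  exists (N^°, le i1); first by split => /=; [exact: nbhs_interior|exists i1].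
  case=> b i [/= Nb i1i] /(_ N Nb)[_ [[j ij <-] Nj]]; apply: AN; exists (z j).
  by split => //; apply: i1A; exact (directed_trans dirI i1i ij).
(* Some star of [K] avoids the tail from [i0], while attraction puts all late terms of the net into
   it. *)
have [||U OU UK] := admissible_star O_adm _ Kc (i0K i0 _).
- by apply: closed_openC; exact: closed_closure.
- exact (directed_refl dirI i0).
have [A FA AK] := Katt _ bx _ OU.
have [i1 i1A] := tF _ FA.
have [j [i0j i1j]] := directed_ub dirI i0 i1.
have /AK/UK : act mu A (range x) (z j).
  by exists (t j); [exact: i1A|exists (x j) => //; exists j].
by apply; apply: subset_closure; exists j.
Qed.

Lemma attractor_omega_limit (K : set X) : global_attractor O mu F K ->
  K = \bigcup_(Y in cov_bounded O) omega_limit mu F Y.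
Proof.
move=> [K0 Kcl Kc Kinv Katt]; apply/seteqP; split=> [p Kp|p [Y bY omp]].
  (* [K] is bounded and equals [act mu A K] for every [A] in [F], so it lies in its own omega-limit
     set. *)
  exists K; first exact: compact_cov_bounded.
  by move=> A FA; rewrite act_invariant//; exact: subset_closure.
apply: contrapT => nKp.
have [|||U OU UK] := admissible_star O_adm (Y := ~` K) (K := [set p]).
- exact: closed_openC.
- exact: compact_set1.
- by move=> _ ->.
(* A point [q] of [act mu A Y] is [V]-close both to [p] and to some [a] in [K]; doubling puts [a] in
   the [U]-star of [p], which avoids [K]. *)
have [V OV VU] := admissible_half O_adm OU.
have [A FA AK] := Katt _ bY _ OV.
have /(closure_sub_star O_replete OV)[W [VW [q [Aq Wq]] Wp]] := omp A FA.
have [W' [VW' [a [Ka W'a]] W'q]] := AK _ Aq.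
apply: (UK a) => //.
apply: (half_refines_star VU (x := q)); apply/star1P; first by exists W.
by exists W'.
Qed.

(** * Construction of an attractor from the three conditions *)

Lemma asymptotically_compact_cluster (Y : set X) (G : set_system X) :
  asymptotically_compact O mu F -> cov_bounded O Y -> Filter G ->
  (forall A E, F A -> G E -> (act mu A Y `&` E) !=set0) ->
  (omega_limit mu F Y `&` cluster G) !=set0.
Proof.
move=> ac bY filterG meets.
have [I [le [x [t [dirI xY tF zG]]]]] := exists_diverging_net F_basis _ meets.
have [i0] := directed_inhabited dirI.
have bx : bounded_net O x.
  by apply: sub_cov_bounded bY => //; exists (x i0); exists i0.
have [p clp] := subnet_cluster (ac _ _ _ _ dirI bx tF).
exists p; split; first exact: cluster_omega_limit xY tF _ clp.
by move=> A B /zG; exact: clp.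
Qed.

Lemma closed_omega_limit (Y : set X) : closed (omega_limit mu F Y).
Proof. by apply: closed_bigI => A _; exact: closed_closure. Qed.

Lemma omega_limit_cov_bounded (Y : set X) : eventually_bounded O mu F ->
  cov_bounded O Y -> omega_limit mu F Y !=set0 ->
  cov_bounded O (omega_limit mu F Y).
Proof.
move=> eb bY om0; have [A FA bA] := eb _ bY.
apply: (sub_cov_bounded om0 _ (closure_cov_bounded O_replete bA)) => p; exact.
Qed.

Lemma omega_limit_absorbs (D Y : set X) : (forall s, continuous (mu s)) ->
  absorbs mu F D Y -> invariant_set mu (omega_limit mu F Y) ->
  omega_limit mu F Y `<=` omega_limit mu F D.
Proof.
move=> mu_cont [A0 FA0 A0D] inv p omp A FA.
have [s As] := basis_neq0 FA.
(* Here [p] is [mu s q] with [q] in the omega-limit set of [Y]. By continuity a neighbourhood of [p]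
   pulls back to one of [q], which meets [act mu A0 Y] and hence [D]. *)
move: omp; rewrite -{1}(inv s) => -[q omq <-] N.
move=> /(mu_cont s q)/(omq A0 FA0)[y [/A0D Dy Ny]].
by exists (mu s y); split => //; exists s => //; exists y.
Qed.

Lemma omega_limit_attractor (D : set X) : (forall s, continuous (mu s)) ->
  (forall Y, cov_bounded O Y -> invariant_set mu (omega_limit mu F Y)) ->
  eventually_bounded O mu F -> asymptotically_compact O mu F ->
  cov_bounded O D -> (forall Y, cov_bounded O Y -> absorbs mu F D Y) ->
  global_attractor O mu F (omega_limit mu F D).
Proof.
move=> mu_cont inv eb ac bD absD.
have omD Y : cov_bounded O Y -> omega_limit mu F Y `<=` omega_limit mu F D.
  by move=> bY; apply: omega_limit_absorbs => //; [exact: absD|exact: inv].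
have om0 : omega_limit mu F D !=set0.
  (* For the trivial filter the cluster lemma simply yields a point of the omega-limit set. *)
  have [|p [omp _]] :=
      asymptotically_compact_cluster ac bD (G := globally setT) _ _.
    move=> A E FA ET; have [x Ax] := act_neq0 FA bD.1.
    by exists x; split => //; exact: ET.
  by exists p.
split=> //.
- exact: closed_omega_limit.
(* As [K] is bounded and invariant, a proper filter containing [K] meets every [act mu A K]. It
   clusters in the omega-limit set of [K], which [omD] places inside [K]. *)
- move=> G Gproper Gom; set K := omega_limit mu F D in Gom *.
  have bK : cov_bounded O K by exact: omega_limit_cov_bounded.
  have [|p [omp clp]] := asymptotically_compact_cluster ac bK (G := G) _ _.
    move=> A E FA GE; rewrite act_invariant//; last exact: inv.
    exact: filter_ex (filterI Gom GE).
  by exists p; split => //; exact: omD omp.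
- exact: inv.
- move=> Y bY U OU; apply: contrapT => natt.
  (* If attraction fails, every [act mu A Y] meets the complement of the star. The principal filter
     of this complement then clusters at a point of the open star, which is absurd. *)
  have [|p [omp clp]] := asymptotically_compact_cluster ac bY
      (G := globally (~` star (omega_limit mu F D) U)) _ _.
    move=> A E FA GE; apply: contrapT => AE; apply: natt; exists A => // x Ax.
    by apply: contrapT => nx; apply: AE; exists x; split => //; apply: GE.
  have pU : star (omega_limit mu F D) U p.
    exact: (sub_star O_replete OU) (omD _ bY _ omp).
  have nU : nbhs p (star (omega_limit mu F D) U).
    by apply: open_nbhs_nbhs; split => //; exact (open_star O_replete _ OU).
  by have [x []] := clp (~` star (omega_limit mu F D) U) _ (fun x => id) nU.
Qed.

End Attractor.

Theorem theorem4 (X : topologicalType) (O : set (set (set X)))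
    (S : topologicalSemigroupType) (mu : S -> X -> X) (F : set (set S))
    (X_cr : completely_regular_space X) (O_replete : replete O)
    (mu_action : is_action mu) (mu_cont : forall s, continuous (mu s))
    (F_basis : filter_basis F) :
  (forall A : set X, global_attractor O mu F A ->
    [/\ eventually_bounded O mu F,
        bounded_dissipative O mu F,
        asymptotically_compact O mu F,
        A = \bigcup_(Y in cov_bounded O) omega_limit mu F Y &
        \bigcup_(Y in cov_bounded O) omega_limit mu F Y =
        [set p | exists (I : Type) (le : I -> I -> Prop) (x : I -> X)
                   (t : I -> S),
           [/\ directed le, bounded_net O x, diverges F le t &
               (fun i => mu (t i) (x i)) @ tails le --> p]]]) /\
  ((forall Y, cov_bounded O Y -> invariant_set mu (omega_limit mu F Y)) ->
   eventually_bounded O mu F ->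
   bounded_dissipative O mu F ->
   asymptotically_compact O mu F ->
   exists A, global_attractor O mu F A).
Proof.
split=> [K attK|inv eb [D bD absD] ac].
  split.
  - exact: attractor_eventually_bounded attK.
  - exact: attractor_bounded_dissipative attK.
  - exact: attractor_asymptotically_compact attK.
  - exact: attractor_omega_limit attK.
  - by apply/seteqP; split=> p /(omega_limit_netP F_basis).
exists (omega_limit mu F D); exact: omega_limit_attractor.
Qed.
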